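(* For every prime $p$ and every positive integer $d$, we have $n(\mathbb{Z}_p^d)\le 5d\cdot f(p,d)$.
   Context: A complete digraph on $n$ vertices has, for every two distinct vertices $x,y$, both arcs $(x,y)$ and $(y,x)$ (and no loops). For an Abelian group $(\Gamma,+)$, a $\Gamma$-labelling of a digraph $D$ is a map $w\colon A(D)\to\Gamma$ from its arc set. A directed cycle $C$ with vertices $v_i$, $i\in\mathbb{Z}_\ell$ ($\ell\ge 2$), and arcs $(v_i,v_{i+1})$, $i\in\mathbb{Z}_\ell$, is zero-sum if $\sum_{i=0}^{\ell-1} w(v_i,v_{i+1})=0$ in $\Gamma$ (directed cycles of length $2$, i.e. $x\to y\to x$, are allowed). $n(\Gamma)$ denotes the smallest positive integer $n$ such that every $\Gamma$-labelled complete digraph on $n$ vertices contains a zero-sum directed cycle. For a prime $p$ and $d\in\mathbb{N}$, $f(p,d)$ denotes the smallest positive integer $m$ such that for every collection $B_1,\dots,B_m$ of linear bases of the vector space $\mathbb{Z}_p^d$ over $\mathbb{F}_p$, the multiset union $B_1\cup\dots\cup B_m$ is an additive basis of $\mathbb{Z}_p^d$, i.e. every element of $\mathbb{Z}_p^d$ is the sum of the elements of some (possibly empty) sub-multiset of $B_1\cup\dots\cup B_m$. *)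

(* Defs.v *)
From HB Require Import structures.
From mathcomp Require Import all_boot all_order all_algebra.
Set Implicit Arguments. Unset Strict Implicit. Unset Printing Implicit Defensive.
Import GRing.Theory.
Local Open Scope ring_scope.

(* A Gamma-labelling of the complete digraph on vertex set 'I_n is a map
   w : 'I_n -> 'I_n -> Gamma; w x y is the label of the arc (x,y) (the value on
   the diagonal is irrelevant, since there are no loops and cycles below never
   use them). A directed cycle is a duplicate-free sequence c of >= 2 vertices,
   with arcs (x, next c x); it is zero-sum if the sum of its arc labels is 0. *)
Definition has_zero_sum_cycle (G : zmodType) (n : nat) (w : 'I_n -> 'I_n -> G) :=
  exists c : seq 'I_n, [/\ uniq c, (2 <= size c)%N & \sum_(x <- c) w x (next c x) = 0].

Definition zero_sum_forced (G : zmodType) (n : nat) :=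
  forall w : 'I_n -> 'I_n -> G, has_zero_sum_cycle w.

Definition additive_basis (V : zmodType) (S : seq V) :=
  forall x : V, exists msk : bitseq, x = \sum_(v <- mask msk S) v.

Definition f_prop (p d m : nat) :=
  forall B : 'I_m -> seq 'rV['F_p]_d,
    (forall i, basis_of fullv (B i)) ->
    additive_basis (flatten [seq B i | i <- enum 'I_m]).

Definition least_pos (P : nat -> Prop) (k : nat) :=
  [/\ (0 < k)%N, P k & forall j, (0 < j)%N -> P j -> (k <= j)%N].

(* Main.v *)
(** Given a path x -> y -> z, shortcutting it to x -> z changes its weight by the
    "detour" w(x,y) + w(y,z) - w(x,z).  If [m = f(p,d)] and there are [m d]
    disjoint triples whose detours form [m] bases, a cycle through all of them can
    be given any weight by choosing which shortcuts to take.  In general, take a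
    largest family [F] of disjoint triples whose detours split into [m] independent
    sets, and the largest subspace [W] which [F] fills, i.e. which contains
    [m dim W] of the detours: then all detours in the set [R] of unused vertices lie
    in [W].  The triples of [F] inside [W] are as good as [m] bases of [W], but the
    arcs joining them to [R] may have weights that are not balanced modulo [W].  For
    each triple with this defect remove from [R] the (at most two) vertices
    of [R] that witness it, and pass to the largest filled subspace [U] of [W]
    containing no defective triple.  An exchange argument shows that all detours
    in what remains of [R] lie in [U]; since at most [m (dim W - dim U)] triples are
    defective, [R] keeps at least [2 m dim U] vertices.  When no defective triple is
    left, a cycle visiting alternately the triples in [W] and vertices of [R]
    has weight in [W] whatever the shortcuts, and some choice of shortcuts makes
    it zero. *)
Require Import Defs.
From HB Require Import structures.
From mathcomp Require Import all_boot all_order all_algebra.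
From mathcomp Require Import zify.
From Stdlib Require Import Classical.
Set Implicit Arguments. Unset Strict Implicit. Unset Printing Implicit Defensive.
Import GRing.Theory.
Local Open Scope ring_scope.

(** * Extremal choice in sets of natural numbers *)

Lemma ex_max_classic (P : nat -> Prop) (b k : nat) :
  P k -> (forall j, P j -> (j <= b)%N) ->
  exists2 M, P M & forall j, P j -> (j <= M)%N.
Proof.
move=> Pk Pb; have [e] := ubnP (b - k)%N.
elim: e => // e IHe in k Pk *; rewrite ltnS => le.
have [[j [Pj lt]] | no] := classic (exists j, P j /\ (k < j)%N).
  by apply: (IHe j Pj); have := Pb _ Pj; lia.
exists k => // j Pj; rewrite leqNgt; apply/negP=> lt; apply: no; by exists j.
Qed.

Lemma ex_min_classic (P : nat -> Prop) (k : nat) :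
  P k -> exists2 M, P M & forall j, P j -> (M <= j)%N.
Proof.
elim/ltn_ind: k => k IHk Pk.
have [[j [Pj lt]] | no] := classic (exists j, P j /\ (j < k)%N).
  exact: IHk Pj.
exists k => // j Pj; rewrite leqNgt; apply/negP=> lt; apply: no; by exists j.
Qed.

Lemma card_bigcup_le (I Y : finType) (D : {set I}) (F : I -> {set Y}) k :
  (forall i, i \in D -> #|F i| <= k)%N -> (#|\bigcup_(i in D) F i| <= k * #|D|)%N.
Proof.
move=> Fk; rewrite mulnC -sum_nat_const.
apply: (@leq_trans (\sum_(i in D) #|F i|)%N); last exact: leq_sum.
elim/big_rec2: _ => [|i n Z _ le]; first by rewrite cards0.
by rewrite cardsU (leq_trans (leq_subr _ _)) // leq_add2l.
Qed.

(** * Multisets of vectors that split into m independent sets *)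

Section Sparse.
Variables (K : fieldType) (V : vectType K) (T : finType) (v : T -> V) (m : nat).
Implicit Types (A B : {set T}) (U W : {vspace V}) (t : T).

Definition inside A U := [set t in A | v t \in U].

(** Edmonds' condition for splitting the vectors of [A] into [m] independent sets; at [U] zero it
    excludes zero vectors. *)
Definition sparse A := forall U, (#|inside A U| <= m * \dim U)%N.

Definition tight A U := #|inside A U| = (m * \dim U)%N.

Lemma insideP A U t : reflect (t \in A /\ v t \in U) (t \in inside A U).
Proof. by rewrite inE; apply: andP. Qed.

Lemma insideI A U W : inside A (U :&: W)%VS = inside A U :&: inside A W.
Proof. by apply/setP=> t; rewrite !inE memv_cap; case: (t \in A). Qed.

Lemma insideU_sub A U W : inside A U :|: inside A W \subset inside A (U + W)%VS.
Proof.
apply/subsetP=> t; rewrite !inE => /orP[] /andP[-> Ut] /=.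
  exact: subvP (addvSl U W) _ Ut.
exact: subvP (addvSr U W) _ Ut.
Qed.

Lemma insideS A B U : A \subset B -> inside A U \subset inside B U.
Proof. by move=> /subsetP AB; apply/subsetP=> t; rewrite !inE => /andP[/AB -> ->]. Qed.

Lemma inside_id A U : (forall t, t \in A -> v t \in U) -> inside A U = A.
Proof. by move=> AU; apply/setP=> t; rewrite inE; case tA: (t \in A) => //=; rewrite AU. Qed.

Lemma sparseS A B : A \subset B -> sparse B -> sparse A.
Proof. by move=> AB sB U; apply: leq_trans (sB U); apply/subset_leq_card/insideS. Qed.

(** The number of vectors in a subspace is supermodular and the bound [m * \dim] is modular, so
    equality at [U] and [W] forces equality at their sum and intersection, and in [insideU_sub]. *)
Lemma tight_lattice A U W : sparse A -> tight A U -> tight A W ->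
  [/\ tight A (U + W), tight A (U :&: W)
    & inside A (U + W) = inside A U :|: inside A W].
Proof.
move=> sA tU tW.
have e1 := cardsUI (inside A U) (inside A W).
have e2 := dimv_sum_cap U W.
have l1 := subset_leq_card (insideU_sub A U W).
have l2 := sA (U + W)%VS; have l3 := sA (U :&: W)%VS.
have e3 : (m * \dim (U + W) + m * \dim (U :&: W) = m * \dim U + m * \dim W)%N.
  by rewrite -!mulnDr e2.
rewrite /tight insideI in tU tW l3 *.
split; [lia | lia | apply/eqP].
by rewrite eq_sym eqEcard insideU_sub /=; lia.
Qed.

Lemma tight0 A : sparse A -> tight A 0%VS.
Proof. by move=> /(_ 0%VS); rewrite /tight dimv0 muln0 leqn0 => /eqP. Qed.

(** A new element raises each count by at most one, so a subspace that it overfills was tight and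
    contains its vector. *)
Lemma not_sparseU1 A t : sparse A -> ~ sparse (t |: A) ->
  exists2 U, tight A U & v t \in U.
Proof.
move=> sA /not_all_ex_not[U /negP]; rewrite -ltnNge => ltU.
have sub : inside (t |: A) U \subset t |: inside A U.
  by apply/subsetP=> s; rewrite !inE => /andP[/orP[-> //|->] ->]; rewrite orbT.
have := sA U; have := subset_leq_card sub; rewrite cardsU1 => l1 l2.
exists U; first by rewrite /tight; case: (t \notin _) l1 => /=; lia.
apply/negPn/negP=> tU.
suff : inside (t |: A) U \subset inside A U by move/subset_leq_card; lia.
apply/subsetP=> s; rewrite !inE => /andP[/orP[/eqP->|->] //].
by rewrite (negPf tU).
Qed.

Lemma inside_swap A B U W : (U <= W)%VS -> (forall t, t \in B -> v t \in U) ->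
  #|B| = #|inside A U| -> #|inside (B :|: A :\: inside A U) W| = #|inside A W|.
Proof.
move=> UW BU cB.
have -> : inside (B :|: A :\: inside A U) W = B :|: (inside A W :\: inside A U).
  apply/setP=> t; rewrite !inE; case: (boolP (t \in B)) => [/BU/(subvP UW) -> //|_].
  by case: (t \in A); rewrite /= ?andbT.
rewrite cardsU; have -> : B :&: (inside A W :\: inside A U) = set0.
  apply/setP=> t; rewrite !inE; case: (boolP (t \in B)) => // /BU ->.
  by case: (t \in A).
have sub : inside A U \subset inside A W.
  by apply/subsetP=> t; rewrite !inE => /andP[-> /(subvP UW)].
by rewrite cards0 subn0 cardsDS ?cB ?subnKC ?subset_leq_card.
Qed.

(** Supermodularity at [Q] and [U]: inside [U] the new family is just [B], and in [Q + U] it has as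
    many vectors as [A]; the modular law for dimensions then gives the bound at [Q]. *)
Lemma sparse_swap A B U : sparse A -> tight A U ->
  sparse B -> (forall t, t \in B -> v t \in U) -> #|B| = (m * \dim U)%N ->
  sparse (B :|: A :\: inside A U).
Proof.
move=> sA tU sB BU cB Q.
have e : #|B| = #|inside A U| by rewrite cB -tU.
have l1 : (#|inside (B :|: A :\: inside A U) Q| + #|B| <=
          #|inside (B :|: A :\: inside A U) (Q + U)| + #|inside B (Q :&: U)|)%N.
  set C := B :|: _.
  have -> : B = inside C U.
    apply/setP=> t; rewrite !inE; case: (boolP (t \in B)) => [/BU -> //|_].
    by case: (t \in A) => //=; rewrite ?andbF //; case: (v t \in U).
  rewrite -cardsUI leq_add // ?subset_leq_card ?insideU_sub //.
  rewrite -insideI; apply/subsetP=> t; rewrite !inE memv_cap.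
  by move=> /andP[-> /andP[-> ->]].
rewrite (inside_swap (addvSr Q U) BU e) in l1.
have l2 := sA (Q + U)%VS; have l3 := sB (Q :&: U)%VS.
have e2 : (m * \dim (Q + U) + m * \dim (Q :&: U) = m * \dim Q + m * \dim U)%N.
  by rewrite -!mulnDr dimv_sum_cap.
by lia.
Qed.

(* Rado's argument: the lists [J t] of admissible colours are shrunk one colour
   at a time; submodularity of the dimension shows that if two colours of the
   same list are both indispensable, then the Hall-type condition already fails. *)
Lemma sparse_coloring A : (0 < m)%N -> sparse A ->
  exists c : T -> 'I_m,
    forall j, free [seq v t | t <- enum [set t in A | c t == j]].
Proof.
move=> m_gt0 sA.
(* [hall] is Rado's condition: summed over the colours, the ranks of the vectors of [I] admitting
   each colour reach the size of [I]. *)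
pose rho (J : T -> {set 'I_m}) (I : {set T}) :=
  (\sum_j \dim (\sum_(t in I | j \in J t) <[v t]>))%N.
pose hall J := [forall I : {set T}, (I \subset A) ==> (#|I| <= rho J I)%N].
suff [J hJ sJ] : exists2 J, hall J & forall t, t \in A -> (#|J t| <= 1)%N.
  have J1 t : t \in A -> exists j, J t = [set j].
    move=> tA; apply/cards1P; rewrite eqn_leq sJ //= card_gt0.
    apply/eqP => Jt0; have /forallP/(_ [set t]) := hJ.
    rewrite sub1set tA cards1 /rho big1 // => j _.
    rewrite big_pred0 ?dimv0 // => s; rewrite inE; case: eqP => // ->.
    by rewrite Jt0 inE.
  pose c t := odflt (Ordinal m_gt0) [pick j in J t].
  have cJ t : t \in A -> J t = [set c t].
    move=> tA; have [j Jt] := J1 _ tA; rewrite /c Jt.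
    by case: pickP => [k | /(_ j)]; rewrite inE ?eqxx // => /eqP->.
  (* Once the lists are singletons, [rho] of a colour class is its rank, so [hall] makes the class
     free. *)
  exists c => j; set I := [set _ in _ | _].
  have IA : I \subset A by apply/subsetP=> t; rewrite inE => /andP[].
  have /forallP/(_ I) := hJ; rewrite IA /= /rho (bigD1 j) //=.
  rewrite [X in (_ <= _ + X)%N]big1; last first.
    move=> k kj; rewrite big_pred0 ?dimv0 // => t.
    rewrite inE; case: (boolP (t \in A)) => //= tA; rewrite cJ // inE.
    by case: eqP => // ->; rewrite (negPf kj).
  rewrite addn0 => le; rewrite /free eqn_leq dim_span size_map -cardE /=.
  apply: leq_trans le _; apply: dimvS; apply/subv_sumP=> t /andP[tI _].
  by rewrite -memvE memv_span // map_f // mem_enum.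
(* With every colour allowed, [hall] at [I] is [sparse] at the span of [I]. *)
have : exists2 J, hall J & (\sum_(t in A) #|J t| <= #|A| * m)%N.
  exists (fun=> setT); last first.
    by rewrite sum_nat_const cardsT card_ord.
  apply/forallP=> I; apply/implyP=> IA.
  rewrite /rho (eq_bigr (fun=> \dim (\sum_(t in I) <[v t]>))); last first.
    by move=> j _; congr (\dim _); apply: eq_bigl => t; rewrite inE andbT.
  rewrite sum_nat_const card_ord; apply: leq_trans (sA _).
  apply/subset_leq_card/subsetP=> t tI; rewrite inE (subsetP IA) //= memvE.
  exact: (sumv_sup t).
elim: (_ * m)%N => [|k IHk] [J hJ sJ].
  exists J => // t tA; apply: leq_trans (leqnSn _).
  by move: sJ; rewrite (bigD1 t) //=; lia.
have [/exists_inP[t tA] | noJ] := boolP [exists t in A, (1 < #|J t|)%N]; last first.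
  exists J => // t tA; rewrite leqNgt; apply: contra noJ => lt1.
  by apply/exists_inP; exists t.
move=> /card_gt1P[x [y [xJ yJ xy]]].
pose del z s := if s == t then J s :\ z else J s.
have sdel z : z \in J t -> (\sum_(s in A) #|del z s| <= k)%N.
  move=> zJ; move: sJ; rewrite (bigD1 t) //= [X in _ -> (X <= _)%N](bigD1 t) //=.
  rewrite {1}/del eqxx (cardsD1 z) zJ.
  rewrite [X in _ -> (_ + X <= _)%N](eq_bigr (fun s => #|J s|)) // => s.
  by case/andP=> _ /negPf st; rewrite /del st.
have [hx | /forallPn[I nI]] := boolP (hall (del x));
  first by apply: IHk; exists (del x); rewrite ?sdel.
have [hy | /forallPn[I' nI']] := boolP (hall (del y));
  first by apply: IHk; exists (del y); rewrite ?sdel.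
move: nI nI'; rewrite !negb_imply -!ltnNge => /andP[IA ltI] /andP[I'A ltI'].
have tI z (L : {set T}) : L \subset A -> (rho (del z) L < #|L|)%N -> t \in L.
  move=> LA lt; apply/negPn/negP=> tL; move: lt; apply/negP; rewrite -leqNgt.
  have /forallP/(_ L) := hJ; rewrite LA /= => /leq_trans-> //.
  apply: leq_sum => j _; apply: dimvS; apply/subv_sumP=> s /andP[sL js].
  apply: (sumv_sup s); rewrite // sL /del; case: eqP => // st.
  by rewrite st (negPf tL) in sL.
have [tI1 tI2] := (tI _ _ IA ltI, tI _ _ I'A ltI').
(* Only the list of [t] was changed, and since [x] and [y] differ, each of its colours survives in
   one of the two deletions. The sets on the left have total size [#|I| + #|I'| - 1], while the
   right side is at most [#|I| + #|I'| - 2], against [hall J]. *)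
have key : (rho J (I :|: I') + rho J ((I :&: I') :\ t) <= rho (del x) I + rho (del y) I')%N.
  rewrite -!big_split /=; apply: leq_sum => j _; rewrite -[leqRHS]dimv_sum_cap leq_add //.
    apply: dimvS; apply/subv_sumP=> s /andP[].
    have [-> _ jJ | st] := eqVneq s t.
      have [jx | jx] := eqVneq j x.
        apply: subv_trans (addvSr _ _); apply: (sumv_sup t) => //.
        by rewrite tI2 /del eqxx !inE jJ jx xy.
      apply: subv_trans (addvSl _ _); apply: (sumv_sup t) => //.
      by rewrite tI1 /del eqxx !inE jJ jx.
    rewrite inE => /orP[] sI js.
      by apply: subv_trans (addvSl _ _); apply: (sumv_sup s) => //; rewrite sI /del (negPf st).
    by apply: subv_trans (addvSr _ _); apply: (sumv_sup s) => //; rewrite sI /del (negPf st).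
  apply: dimvS; apply/subv_sumP=> s /andP[]; rewrite !inE => /and3P[st sI sI'] js.
  rewrite subv_cap; apply/andP; split; apply: (sumv_sup s) => //;
    by rewrite ?sI ?sI' /del (negPf st).
have /forallP/(_ (I :|: I')) := hJ; rewrite subUset IA I'A /=.
have /forallP/(_ ((I :&: I') :\ t)) := hJ.
rewrite (subset_trans (subD1set _ _)) ?(subset_trans (subsetIl _ _)) //=.
have := cardsUI I I'; rewrite [#|I :&: I'|](cardsD1 t) inE tI1 tI2 /=.
lia.
Qed.

End Sparse.

(** Counting makes every colour class a basis of [W]. Adding to each a basis [D] of a complement
    gives [m] bases of the whole space; projecting a representation of [u] along the complement
    kills the copies of [D]. *)
Lemma sparse_sums (K : fieldType) (V : vectType K) (T : finType) (v : T -> V)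
    (m : nat) (A : {set T}) (W : {vspace V}) : (0 < m)%N ->
  (forall B : 'I_m -> seq V, (forall i, basis_of fullv (B i)) ->
     additive_basis (flatten [seq B i | i <- enum 'I_m])) ->
  sparse v m A -> (forall t, t \in A -> v t \in W) -> #|A| = (m * \dim W)%N ->
  forall u, u \in W -> exists2 S : {set T}, S \subset A & \sum_(t in S) v t = u.
Proof.
move=> m_gt0 addB sA AW cA u uW.
have [c cfree] := sparse_coloring m_gt0 sA.
pose C i := enum [set t in A | c t == i].
have CA i t : t \in C i -> t \in A /\ c t = i.
  by rewrite mem_enum inE => /andP[-> /eqP].
have CW i : (<<[seq v t | t <- C i]>> <= W)%VS.
  by apply/span_subvP=> _ /mapP[t /CA[tA _] ->]; apply: AW.
have szle i : (size (C i) <= \dim W)%N.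
  by have := cfree i; rewrite -/(C i) /free size_map => /eqP <-; apply: dimvS.
have sz i : size (C i) = \dim W.
  have sumC : (\sum_j size (C j) = \sum_(j < m) \dim W)%N.
    rewrite sum_nat_const card_ord -cA -sum1_card (partition_big c xpredT) //=.
    apply: eq_bigr => j _; rewrite sum1_card -cardE.
    by apply: eq_card => t; rewrite inE.
  apply/eqP; rewrite eqn_leq szle /= leqNgt; apply/negP=> lt.
  move: sumC; rewrite (bigD1 i) // [RHS](bigD1 i) //=.
  move=> e; have := leq_add lt (leq_sum _ (fun j (_ : j != i) => szle j)).
  by move/(_ (index_enum _)); rewrite addSn e ltnn.
pose D := vbasis W^C; pose k := \dim W^C.
(* Labels keep equal vectors apart, so that a mask yields a genuine subset of [A]. *)
pose f (q : T + 'I_m * 'I_k) := match q with inl t => v t | inr p => D`_p.2 end.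
pose s i : seq (T + 'I_m * 'I_k) :=
  [seq inl t | t <- C i] ++ [seq inr (i, j) | j <- enum 'I_k].
have fs i : [seq f q | q <- s i] = [seq v t | t <- C i] ++ D.
  rewrite map_cat -map_comp -[X in _ ++ X]map_comp; congr (_ ++ _).
  by rewrite -[RHS](mkseq_nth 0) size_tuple /mkseq -val_enum_ord -map_comp.
have [|msk def_u] := addB (fun i => [seq f q | q <- s i]) _ u.
  move=> i; rewrite fs -(addv_complf W); apply: cat_basis (vbasisP _).
    exact/directv_addP/capv_compl.
  by rewrite basisEfree cfree CW size_map sz leqnn.
pose M := mask msk (flatten [seq s i | i <- enum 'I_m]).
pose h (q : T + 'I_m * 'I_k) := if q is inl t then Some t else None.
have eu : u = \sum_(q <- M) f q.
  rewrite def_u (map_comp (map f) s) -map_flatten -map_mask big_map //.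
have split_u : \sum_(q <- M) f q = \sum_(t <- pmap h M) v t
    + \sum_(q <- M) (if q is inr p then D`_p.2 else 0).
  elim: (M) => [|[t|p] M' IH] /=; rewrite ?big_nil ?addr0 // !big_cons IH.
    by rewrite /= add0r addrA.
  by rewrite /= addrCA.
have MA t : t \in pmap h M -> t \in A.
  rewrite mem_pmap => /mapP[[t'|//] tM [->]].
  have /flatten_mapP[i _] := mem_mask tM.
  rewrite mem_cat => /orP[/mapP[t'' /CA[? _] [->]] //|/mapP[j _] //].
have UM : uniq (pmap h M).
  apply: (@pmap_uniq _ _ h inl); first by case.
  apply: mask_uniq.
  have -> : [seq s i | i <- enum 'I_m]
      = [seq [seq q | q <- s i] | i <- enum 'I_m].
    by apply: eq_map => i; rewrite map_id.
  apply: allpairs_uniq_dep => [|i _|]; first exact: enum_uniq.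
    rewrite cat_uniq; apply/and3P; split.
    - by rewrite map_inj_uniq ?enum_uniq // => ? ? [].
    - by apply/hasPn=> _ /mapP[j _ ->]; apply/mapP=> -[].
    - by rewrite map_inj_uniq ?enum_uniq // => ? ? [].
  have tagE i q : q \in s i -> i = if q is inr p then p.1 else if q is inl t then c t else i.
    by rewrite mem_cat => /orP[] /mapP[t tC ->] //; have [_ ->] := CA _ _ tC.
  move=> _ _ /allpairsPdep[i [q [_ iq ->]]] /allpairsPdep[j [r [_ jr ->]]] /= qr.
  rewrite {}qr in iq *.
  suff -> : i = j by [].
  by rewrite (tagE _ _ iq) (tagE _ _ jr); case: (r).
exists [set t in pmap h M]; first by apply/subsetP=> t; rewrite inE => /MA.
rewrite (eq_bigl (mem (pmap h M))) => [|t]; last by rewrite inE.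
rewrite -big_uniq //.
apply/eqP; rewrite -subr_eq0 -memv0 -(capv_compl W) memv_cap; apply/andP; split.
  by rewrite memvB // big_seq; apply: memv_suml => t /MA/AW.
rewrite eu split_u opprD addNKr memvN; apply: memv_suml => -[t|p] _; first exact: mem0v.
by apply: (vbasis_mem (U := W^C)); rewrite mem_nth ?size_tuple.
Qed.

(** * Detours *)

Section Walks.
Variables (V : zmodType) (X : eqType) (w : X -> X -> V).

Fixpoint walk (x : X) (p : seq X) : V :=
  if p is y :: p' then w x y + walk y p' else 0.

Lemma walk_cat x p q : walk x (p ++ q) = walk x p + walk (last x p) q.
Proof. by elim: p x => [|y p IHp] x /=; rewrite ?add0r // IHp addrA. Qed.

Lemma walk_nth x p : walk x p = \sum_(0 <= i < size p) w (nth x (x :: p) i) (nth x p i).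
Proof.
elim: p x => [|y p IHp] x; first by rewrite big_geq.
rewrite [LHS]/= big_nat_recl // IHp; congr (_ + _).
apply: eq_big_nat => i /andP[_ lti] /=.
by congr (w _ _); apply: set_nth_default; rewrite //= ltnW.
Qed.

Lemma sum_next x p : uniq (x :: p) ->
  \sum_(y <- x :: p) w y (next (x :: p) y) = walk x (rcons p x).
Proof.
move=> Up; rewrite (big_nth x) walk_nth size_rcons; apply: eq_big_nat => i /andP[_ lti].
rewrite next_nth mem_nth // index_uniq // -rcons_cons nth_rcons lti nth_rcons.
move: lti; rewrite [size _]/= ltnS leq_eqVlt => /orP[/eqP-> | ->] //.
by rewrite ltnn eqxx [nth x p _]nth_default.
Qed.
End Walks.

(** * Packings of triples with sparse detours *)

Section Gadgets.
Variables (K : fieldType) (V : vectType K) (X : finType) (w : X -> X -> V).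
Variables (m : nat) (m_gt0 : (0 < m)%N).
Let T := (X * X * X)%type.
Implicit Types (A B S : {set T}) (R : {set X}) (U W : {vspace V}) (t g : T).
Implicit Types (o : option T) (prs : seq (option T * X)).

Definition detour t := w t.1.1 t.1.2 + w t.1.2 t.2 - w t.1.1 t.2.

Definition supp t : {set X} := [set t.1.1; t.1.2; t.2].

Definition supps A := \bigcup_(t in A) supp t.

Definition packing A :=
  (forall t, t \in A -> #|supp t| = 3) /\
  (forall s t, s \in A -> t \in A -> s != t -> [disjoint supp s & supp t]).

Lemma supps_sup t A : t \in A -> supp t \subset supps A.
Proof. by move=> tA; apply: (bigcup_sup t). Qed.

Lemma suppsS A B : A \subset B -> supps A \subset supps B.
Proof. by move=> AB; apply/bigcupsP=> t /(subsetP AB)/supps_sup. Qed.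

Lemma packingS A B : A \subset B -> packing B -> packing A.
Proof.
move=> /subsetP AB [B3 dB]; split=> [t /AB/B3 // | s t /AB sB /AB tB]; exact: dB.
Qed.

Lemma disjoint_supps A (Y : {set X}) :
  (forall t, t \in A -> [disjoint supp t & Y]) -> [disjoint supps A & Y].
Proof.
move=> dA; apply/pred0P=> x /=; apply/negP=> /andP[/bigcupP[t tA xt] xY].
by have /pred0P/(_ x) := dA t tA; rewrite /= xt xY.
Qed.

Lemma packingU A B : packing A -> packing B -> [disjoint supps A & supps B] ->
  packing (A :|: B).
Proof.
move=> [A3 dA] [B3 dB] dAB; split=> [t|s t].
  by rewrite inE => /orP[/A3|/B3].
rewrite !inE => /orP[] sA /orP[] tA st; try by [apply: dA | apply: dB].
  exact: disjointWl (supps_sup sA) (disjointWr (supps_sup tA) dAB).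
rewrite disjoint_sym.
exact: disjointWl (supps_sup tA) (disjointWr (supps_sup sA) dAB).
Qed.

Lemma packing1 t : #|supp t| = 3 -> packing [set t].
Proof.
move=> t3; split=> [s /set1P-> // | s r /set1P-> /set1P->]; by rewrite eqxx.
Qed.

Lemma supps1 t : supps [set t] = supp t.
Proof. by rewrite /supps big_set1. Qed.

Lemma suppsU A B : supps (A :|: B) = supps A :|: supps B.
Proof. by rewrite /supps bigcup_setU. Qed.

Lemma supp_disjoint_notin A t :
  #|supp t| = 3 -> [disjoint supp t & supps A] -> t \notin A.
Proof.
move=> t3 d; apply/negP=> tA.
have := disjointWr (supps_sup tA) d.
by rewrite -setI_eq0 setIid -cards_eq0 t3.
Qed.

(* [A] amounts to [m] bases of [W] (by [sparse_coloring]). *)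
Definition multibasis A W :=
  [/\ sparse detour m A, forall t, t \in A -> detour t \in W
    & #|A| = (m * \dim W)%N].

(* The last clause holds for the part [A] in [W] of a largest packing with sparse
   detours: an exchange violating it would enlarge that packing.  The three spare
   vertices, absent when [W] is everything, make 2-cycles in [R] decompose. *)
Definition rigid W A R :=
  [/\ packing A, multibasis A W, [disjoint supps A & R],
      (2 * m * \dim W + 3 * (W != fullv) <= #|R|)%N
    & forall A' t, multibasis A' W -> packing (t |: A') -> t \notin A' ->
        supps (t |: A') \subset supps A :|: R -> detour t \in W].

(** No triple of [A] is defective; [walk_block0] uses this to compare arcs joining [A] to [R] with
    arcs inside [R]. *)
Definition aligned W A R := forall g t, g \in A -> #|supp t| = 3 ->
  supp t \subset supp g :|: R -> detour t \in W.

Lemma multibasis_tight A W : multibasis A W -> tight detour m A W.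
Proof. by case=> _ AW cA; rewrite /tight inside_id. Qed.

(** As [t] avoids the vertices of [A], the last clause of [rigid] applies with [A] itself as
    [A']. *)
Lemma rigid_triple W A R t : rigid W A R -> #|supp t| = 3 -> supp t \subset R ->
  detour t \in W.
Proof.
move=> [pA mA dAR _ inv] t3 tR.
have dt : [disjoint supp t & supps A].
  by rewrite disjoint_sym; apply: disjointWr tR dAR.
apply: (inv A) => //.
- by apply: packingU (packing1 t3) pA _; rewrite supps1.
- exact: supp_disjoint_notin.
- by rewrite suppsU supps1 subUset (subset_trans tR) ?subsetUr ?subsetUl.
Qed.

Lemma rigid_refine W A R : rigid W A R ->
  aligned W A R \/ exists U A' R', rigid U A' R' /\ (\dim U < \dim W)%N.
Proof.
move=> rW; have [pA mA dAR cR inv] := rW.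
have [sA AW cA] := mA; have tW := multibasis_tight mA.
pose wit g t := [&& #|supp t| == 3, supp t \subset supp g :|: R & detour t \notin W].
pose bad g := [exists t, wit g t].
have [/exists_inP[g0 g0A g0bad] | nobad] := boolP [exists g in A, bad g]; last first.
  left=> g t gA t3 tR; apply/negPn/negP=> tW'.
  move/negP: nobad; apply; apply/exists_inP; exists g => //.
  by apply/existsP; exists t; rewrite /wit t3 eqxx tR.
right.
pose f g := odflt g [pick t | wit g t].
have fP g : bad g -> [/\ #|supp (f g)| = 3, supp (f g) \subset supp g :|: R
                        & detour (f g) \notin W].
  move=> /existsP[t0 t0P]; rewrite /f; case: pickP => [t /and3P[/eqP t3 ? ?] //|/(_ t0)].
  by rewrite t0P.
(* By [rigid_triple] a witness cannot lie entirely in [R]. *)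
have f2 g : bad g -> (#|supp (f g) :&: R| <= 2)%N.
  move=> /fP[f3 _ fW]; suff /proper_card : supp (f g) :&: R \proper supp (f g).
    by rewrite f3.
  rewrite properEneq subsetIl andbT.
  apply/eqP=> /setIidPl fR; by rewrite (rigid_triple rW) in fW.
(* A defect lies outside [W], so the three spare vertices are present and can be passed on to
   [U]. *)
have WV : W != fullv.
  by apply/eqP=> WV; have [_ _] := fP _ g0bad; rewrite WV memvf.
pose Bad := [set g in A | bad g].
pose R' := R :\: \bigcup_(g in Bad) supp (f g).
pose cand k := exists U, [/\ \dim U = k, tight detour m A U &
   forall g, g \in A -> detour g \in U -> ~~ bad g].
have [||_ [U [<- tU Ubad]] Umax] := @ex_max_classic cand (\dim {:V}) 0%N.
- exists 0%VS; split; rewrite ?dimv0 //; first exact: tight0.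
  move=> g gA gU0; have := tight0 sA; rewrite /tight dimv0 muln0 => /eqP.
  by rewrite cards_eq0 => /eqP/setP/(_ g); rewrite !inE gA gU0.
- by move=> _ [U [<- _ _]]; rewrite dimvS ?subvf.
have {}Umax U' : tight detour m A U' ->
    (forall g, g \in A -> detour g \in U' -> ~~ bad g) -> (\dim U' <= \dim U)%N.
  by move=> tU' bU'; apply: Umax; exists U'.
(* All of [A] lies in the tight space [U + W], whose dimension is therefore that of [W]. *)
have UW : (U <= W)%VS.
  have [tS _ _] := tight_lattice sA tU tW.
  have : inside detour A (U + W)%VS = A.
    by apply: inside_id => g /AW; apply: subvP (addvSr U W) _.
  move=> e; move: tS; rewrite /tight e cA => /eqP; rewrite eqn_pmul2l // => /eqP dUW.
  have /eqP -> : W == (U + W)%VS by rewrite eqEdim addvSr dUW leqnn.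
  exact: addvSl.
have ltUW : (\dim U < \dim W)%N.
  rewrite ltnNge; apply/negP=> leWU; have eUW : U = W.
    by apply/eqP; rewrite eqEdim UW.
  by have := Ubad g0 g0A; rewrite eUW (AW _ g0A) g0bad => /(_ isT).
pose AU := inside detour A U.
have AUA : AU \subset A by apply/subsetP=> g; rewrite inE => /andP[].
have BadAU : [disjoint Bad & AU].
  apply/pred0P=> g /=; apply/negP; rewrite !inE => /andP[/andP[_ bg] /andP[gA gU]].
  by have := Ubad _ gA gU; rewrite bg.
(* Each unit of dimension lost frees [2 * m] vertices of the required size of [R], which pays for
   two vertices per bad triple. *)
have cBad : (#|Bad| + m * \dim U <= m * \dim W)%N.
  have := cardsUI Bad AU; move: BadAU; rewrite -setI_eq0 => /eqP->.
  rewrite cards0 addn0 -tU -cA => <-; apply/subset_leq_card/subsetP=> g.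
  by rewrite !inE => /orP[] /andP[].
have cR' : (#|R| <= #|R'| + 2 * #|Bad|)%N.
  rewrite -(cardsID (\bigcup_(g in Bad) supp (f g)) R) addnC leq_add2l.
  rewrite setIC big_distrl /=; apply: card_bigcup_le => g.
  by rewrite inE => /andP[_ /f2].
have dAUA g : g \in A -> g \notin AU -> [disjoint supps AU & supp g].
  move=> gA gU; apply: disjoint_supps => h hU; apply: pA.2 => //.
    exact: (subsetP AUA).
  by apply: contraNneq gU => <-.
exists U, AU, R'; split=> //; split.
- exact: packingS pA.
- split; [exact: sparseS sA | | exact: tU].
  by move=> t; rewrite inE => /andP[].
- apply: disjointWl (suppsS AUA) _; apply: disjointWr dAR; exact: subsetDl.
- move: cR; rewrite WV.
  have -> : (U != fullv) = true.
    apply/negP=> /eqP UV; by have := leq_trans ltUW (dimvS (subvf W)); rewrite UV ltnn.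
  have -> : (2 * m * \dim W = 2 * (m * \dim W))%N by rewrite mulnA.
  by rewrite -mulnA; lia.
move=> A' t mA' pA' tA' sub; have [sA' A'U cA'] := mA'.
(* Trading [AU] for [A'] gives another multibasis of [W], so rigidity of [W] puts [detour t] in [W];
   the rest of the proof brings it down to [U]. *)
pose A1 := A' :|: A :\: AU.
have sA1 : sparse detour m A1 by exact: sparse_swap.
have eA' : #|A'| = #|inside detour A U| by rewrite cA' tU.
have swap Q : (U <= Q)%VS -> #|inside detour A1 Q| = #|inside detour A Q|.
  by move=> UQ; apply: inside_swap.
have A1W s : s \in A1 -> detour s \in W.
  by rewrite !inE => /orP[/A'U/(subvP UW)|/andP[_ /AW]].
have tW1 : tight detour m A1 W by rewrite /tight swap.
have cA1 : #|A1| = (m * \dim W)%N by rewrite -tW1 inside_id.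
have R'R : R' \subset R by exact: subsetDl.
have dD : [disjoint supps (t |: A') & supps (A :\: AU)].
  apply: disjointWl sub _; rewrite disjoint_sym; apply: disjoint_supps => g.
  rewrite inE => /andP[gU gA]; rewrite disjoint_sym disjoints_subset subUset.
  rewrite -!disjoints_subset dAUA //= disjoint_sym.
  exact: disjointWl (supps_sup gA) (disjointWr R'R dAR).
have tA1 : t \notin A1.
  rewrite inE (negPf tA') /=; apply: supp_disjoint_notin.
    by apply: pA'.1; rewrite setU11.
  by apply: disjointWl dD; apply: supps_sup; rewrite setU11.
have subA1 : supps (t |: A1) \subset supps A :|: R.
  rewrite /A1 setUA suppsU subUset (subset_trans sub) /=.
    by rewrite (subset_trans (suppsS (subsetDl _ _))) ?subsetUl.
  by apply: setUSS => //; apply: suppsS.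
have pA1 : packing (t |: A1).
  rewrite /A1 setUA; apply: packingU => //; apply: packingS pA; exact: subsetDl.
have tW' : detour t \in W by apply: (inv A1).
apply/negPn/negP=> tU'.
have [|_ [T0 [<- tT tT0]] Tmin] := @ex_min_classic
  (fun k => exists Q, [/\ \dim Q = k, tight detour m A1 Q & detour t \in Q]) (\dim W).
- by exists W.
(* Tight subspaces are closed under intersection, so minimal dimension makes [T0] the least one. *)
have {}Tmin Q : tight detour m A1 Q -> detour t \in Q -> (T0 <= Q)%VS.
  move=> tQ tQ0; have [_ tC _] := tight_lattice sA1 tT tQ.
  have : (\dim T0 <= \dim (T0 :&: Q))%N.
    by apply: Tmin; exists (T0 :&: Q)%VS; rewrite memv_cap tT0 tQ0.
  move=> le; have /eqP <- : (T0 :&: Q == T0)%VS by rewrite eqEdim capvSl.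
  exact: capvSr.
(* If the least tight [T0] containing [detour t] had no bad element, [T0 + U] would
   contradict the maximality of [U]; a bad [h] in [T0] can be exchanged for [t],
   which frees its vertices for the witness [f h], against the rigidity of [W]. *)
have [/exists_inP[h hA /andP[hbad hT]] | noh] :=
    boolP [exists h in A, bad h && (detour h \in T0)]; last first.
  have tU1 : tight detour m A1 U by rewrite /tight swap.
  have [tS _ eS] := tight_lattice sA1 tT tU1.
  have : (\dim (T0 + U) <= \dim U)%N.
    apply: Umax => [|g gA gTU]; first by rewrite /tight -swap ?addvSr.
    have [gU | gU] := boolP (detour g \in U); first exact: Ubad.
    apply/negP=> gbad; move/negP: noh; apply; apply/exists_inP; exists g => //.
    rewrite gbad /=; have : g \in inside detour A1 (T0 + U).
      by rewrite !inE gTU gA (negPf gU) orbT.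
    by rewrite eS !inE (negPf gU) !andbF orbF => /andP[].
  move=> le; move/negP: tU'; apply.
  have /eqP -> : (U == T0 + U)%VS by rewrite eqEdim addvSr.
  exact: subvP (addvSl _ _) _ tT0.
have [fh3 fhR fhW] := fP _ hbad.
have hU : h \notin AU.
  by apply/negP; rewrite inE => /andP[_ /(Ubad _ hA)]; rewrite hbad.
have hA1 : h \in A1 by rewrite in_setU in_setD hU hA orbT.
pose A2 := t |: (A1 :\ h).
have tA1h : t \notin A1 :\ h by rewrite inE negb_and tA1 orbT.
have mA2 : multibasis A2 W.
  split.
  (* A subspace overfilled by [A2] would be tight both for [A1 :\ h] and for [A1]; but it contains
     [T0], hence [detour h], and removing [h] must lower its count. *)
  - have [// | ns] := classic (sparse detour m A2).
    have sA1h : sparse detour m (A1 :\ h) by apply: sparseS sA1; apply: subsetDl.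
    have [Q tQ tQ0] := not_sparseU1 sA1h ns.
    have sub' := insideS detour Q (subsetDl A1 [set h]).
    have tQ1 : tight detour m A1 Q.
      apply/eqP; rewrite eqn_leq sA1 -tQ; exact: subset_leq_card.
    have hQ := subvP (Tmin _ tQ1 tQ0) _ hT.
    have : #|inside detour (A1 :\ h) Q| = #|inside detour A1 Q| by rewrite tQ tQ1.
    move/subset_cardP/(_ sub')/(_ h); rewrite [RHS](introT (insideP _ _ _ _)) //.
    by move/insideP=> []; rewrite setD11.
  - by move=> s; rewrite !inE => /orP[/eqP-> // | /andP[_ sA1']]; apply: A1W; rewrite !inE.
  - by rewrite cardsU1 tA1h -cA1 [in RHS](cardsD1 h) hA1.
have A2A1 : A2 \subset t |: A1 by apply: setUS; apply: subsetDl.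
(* The witness [f h] lives on [supp h] and removed vertices of [R], whereas [t] and [A'] live on
   [AU] and [R']. *)
have dfA2 : [disjoint supp (f h) & supps A2].
  have dfU : [disjoint supps AU :|: R' & supp (f h)].
    rewrite disjoints_subset subUset -!disjoints_subset; apply/andP; split.
      apply: disjointWr fhR _; rewrite disjoint_sym disjoints_subset subUset.
      rewrite -!disjoints_subset ![[disjoint _ & supps AU]]disjoint_sym dAUA //=.
      exact: disjointWl (suppsS AUA) dAR.
    rewrite disjoint_sym; apply: (disjointWl (B := \bigcup_(g in Bad) supp (f g))).
      by apply: (bigcup_sup h); rewrite // inE hA.
    by rewrite -setI_eq0 setIDA setDIl setDv set0I.
  rewrite disjoint_sym; apply: disjoint_supps => s sA2.
  have [sA'' | sA''] := boolP (s \in t |: A').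
    apply: disjointWl dfU; apply: subset_trans sub; exact: supps_sup.
  have [sh sinA sU] : [/\ s != h, s \in A & s \notin AU].
    move: sA2 sA''; rewrite !in_setU1 in_setD1 in_setU in_setD; case: eqP => //= _.
    by case: (s \in A') => //= /and3P[-> -> ->].
  apply: disjointWr fhR _; rewrite disjoint_sym disjoints_subset subUset.
  rewrite -!disjoints_subset pA.2 ?[h == s]eq_sym //= disjoint_sym.
  exact: disjointWl (supps_sup sinA) dAR.
move/negP: fhW; apply; apply: (inv A2) => //.
- apply: packingU; [exact: packing1 | exact: packingS pA1 | by rewrite supps1].
- exact: supp_disjoint_notin.
- rewrite suppsU supps1 subUset (subset_trans (suppsS A2A1)) // andbT.
  apply: subset_trans fhR _; apply: setSU; exact: supps_sup.
Qed.

(** The 5 is 3 + 2: a packing of at most [m * \dim {:V}] triples covers 3 vertices per triple and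
    leaves 2 for [R]. If [W] is not everything, the packing is at least one triple short, whence the
    3 spare vertices. *)
Lemma ex_rigid : (5 * \dim {:V} * m <= #|X|)%N -> exists W A R, rigid W A R.
Proof.
move=> leX; pose good k := exists F : {set T}, [/\ #|F| = k, packing F & sparse detour m F].
have [||_ [F [<- pF sF]] Fmax] := @ex_max_classic good (m * \dim {:V}) 0%N.
- exists set0; split; first exact: cards0.
    by split=> [t|s t]; rewrite inE.
  by move=> U; rewrite [inside _ _ _](_ : _ = set0) ?cards0 //; apply/setP=> t; rewrite !inE.
- move=> _ [F [<- _ sF]]; have := sF fullv.
  by rewrite inside_id // => t _; apply: memvf.
pose tdim k := exists W, \dim W = k /\ tight detour m F W.
have [||_ [W [<- tW]] Wmax] := @ex_max_classic tdim (\dim {:V}) 0%N.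
- by exists 0%VS; rewrite dimv0; split=> //; apply: tight0.
- by move=> _ [W [<- _]]; rewrite dimvS ?subvf.
have {}Wmax U : tight detour m F U -> (U <= W)%VS.
  move=> tU; have [tS _ _] := tight_lattice sF tU tW.
  have /eqP -> : W == (U + W)%VS by rewrite eqEdim addvSr; apply: Wmax; exists (U + W)%VS.
  exact: addvSl.
have cF : (#|F| + (W != fullv) <= m * \dim {:V})%N.
  have iF : inside detour F fullv = F by apply: inside_id => t _; apply: memvf.
  have := sF fullv; rewrite iF; case: eqP => [_|WV]; first by rewrite addn0.
  rewrite addn1 ltn_neqAle => ->; rewrite andbT; apply/eqP => cF; apply: WV.
  apply/eqP; rewrite eqEsubv subvf /=; apply: Wmax.
  by rewrite /tight iF.
pose A := inside detour F W.
have AF : A \subset F by apply/subsetP=> t; rewrite inE => /andP[].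
exists W, A, (~: supps F); split.
- exact: packingS pF.
- split; [exact: sparseS sF | | exact: tW].
  by move=> t; rewrite inE => /andP[].
- rewrite disjoint_sym disjoints_subset setCS; exact: suppsS.
- have c3 : (#|supps F| <= 3 * #|F|)%N.
    by apply: card_bigcup_le => t /pF.1 ->.
  have := cardsC (supps F); have : (m * \dim W <= m * \dim {:V})%N.
    by rewrite leq_mul2l dimvS ?subvf ?orbT.
  move: leX c3 cF; rewrite -!mulnA [(\dim _ * m)%N]mulnC; case: (W != fullv) => /=; lia.
move=> A' t [sA' A'W cA'] pA' tA' sub; apply/negPn/negP=> tW'.
pose F1 := A' :|: F :\: A.
have sF1 : sparse detour m F1 by apply: sparse_swap.
have eA' : #|A'| = #|A| by rewrite cA' -tW.
have swap Q : (W <= Q)%VS -> #|inside detour F1 Q| = #|inside detour F Q|.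
  by move=> WQ; apply: inside_swap.
have pF1 : packing (t |: F1).
  rewrite /F1 setUA; apply: packingU => //.
    by apply: packingS pF; apply: subsetDl.
  apply: disjointWl sub _; rewrite disjoint_sym; apply: disjoint_supps => g.
  rewrite inE => /andP[gA gF]; rewrite disjoint_sym disjoints_subset subUset.
  rewrite -!disjoints_subset; apply/andP; split.
    apply: disjoint_supps => h hA; apply: pF.2 => //; first exact: (subsetP AF).
    by apply: contraNneq gA => <-.
  by rewrite disjoint_sym disjoints_subset setCK supps_sup.
have tF1 : t \notin F1.
  rewrite inE (negPf tA') inE /=; apply/negP=> /andP[tA tF].
  have t3 : #|supp t| = 3 by apply: pA'.1; rewrite setU11.
  have sub' := subset_trans (supps_sup (setU11 t A')) sub.
  have /(disjointWr sub') : [disjoint supp t & supps A :|: ~: supps F].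
    rewrite disjoint_sym disjoints_subset subUset -!disjoints_subset; apply/andP; split.
      apply: disjoint_supps => h hA; apply: pF.2 => //; first exact: (subsetP AF).
      by apply: contraNneq tA => <-.
    by rewrite disjoint_sym disjoints_subset setCK supps_sup.
  by rewrite -setI_eq0 setIid -cards_eq0 t3.
have cF1 : #|F1| = #|F|.
  rewrite -(inside_id (v := detour) (A := F1) (U := fullv)) ?swap ?subvf ?inside_id //;
    by move=> *; exact: memvf.
(* By maximality [t |: F1] is not sparse, so [detour t] lies in a tight [Q]; then [Q + W] is tight
   for [F] too, hence contained in [W]. *)
have [s1 | ns] := classic (sparse detour m (t |: F1)).
  have : (#|t |: F1| <= #|F|)%N by apply: Fmax; exists (t |: F1).
  by rewrite cardsU1 tF1 cF1 ltnn.
have [Q tQ tQ0] := not_sparseU1 sF1 ns.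
have tW1 : tight detour m F1 W by rewrite /tight swap.
have [tS _ _] := tight_lattice sF1 tQ tW1.
move/negP: tW'; apply; apply: (subvP (Wmax (Q + W)%VS _)).
  by rewrite /tight -swap ?addvSr.
exact: subvP (addvSl _ _) _ tQ0.
Qed.

Lemma ex_aligned : (5 * \dim {:V} * m <= #|X|)%N ->
  exists W A R, rigid W A R /\ aligned W A R.
Proof.
move=> /ex_rigid[W [A [R]]]; have [e] := ubnP (\dim W).
elim: e => // e IHe in W A R *; rewrite ltnS => le rW.
have [al | [U [A' [R' [rU lt]]]]] := rigid_refine rW; first by exists W, A, R.
by apply: IHe rU; apply: leq_trans lt le.
Qed.

(* The 2-cycle through [x] and [y] is the sum of two detours through a third vertex. *)
Lemma rigid_return W A R x y : rigid W A R -> x \in R -> y \in R -> x != y ->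
  w x y + w y x \in W.
Proof.
move=> rW xR yR xy; have [_ _ _ cR _] := rW.
have [->|WV] := eqVneq W fullv; first exact: memvf.
have [z zR] : exists z, z \in R :\: [set x; y].
  apply/set0Pn; rewrite -card_gt0 cardsD subn_gt0.
  apply: leq_ltn_trans (subset_leq_card (subsetIr _ _)) _; rewrite cards2 xy.
  by move: cR; rewrite WV; lia.
move: zR; rewrite !inE negb_or => /andP[/andP[zx zy] zR].
have D (a b : X) : a \in R -> b \in R -> a != b -> z != a -> z != b ->
    detour (a, b, z) \in W.
  move=> aR bR ab za zb; apply: (rigid_triple rW).
    by rewrite /supp /= setUC cardsU1 cards2 !inE ab negb_or za zb.
  by rewrite /supp !subUset !sub1set aR bR zR.
have := memvD (D x y xR yR xy zx zy) (D y x yR xR _ zy zx).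
rewrite eq_sym xy /detour /= => /(_ isT).
congr (_ \in W).
by rewrite addrACA -opprD [w x z + w y z]addrC [w x y + _ + _]addrACA addrK.
Qed.

(** * Closed tours through a packing *)

(** [S] holds the triples traversed in full; the others are shortcut. The empty block [None]
    provides a 2-cycle when there are no triples. *)
Definition block S o : seq X :=
  if o is Some t then
    if t \in S then [:: t.1.1; t.1.2; t.2] else [:: t.1.1; t.2]
  else [::].

Definition tour S prs := flatten [seq rcons (block S q.1) q.2 | q <- prs].

Lemma rcons_tour S o r prs a :
  rcons (tour S ((o, r) :: prs)) a = rcons (block S o) r ++ rcons (tour S prs) a.
Proof. by rewrite /tour /= rcons_cat. Qed.

Definition gain S o : V :=
  if o is Some t then if t \in S then detour t else 0 else 0.

Lemma walk_block S o l r :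
  walk w l (rcons (block S o) r) = gain S o + walk w l (rcons (block set0 o) r).
Proof.
case: o => [t|] /=; last by rewrite add0r.
rewrite in_set0; case: ifP => _ /=; last by rewrite add0r.
by rewrite /detour [RHS]addrCA !addrA subrK.
Qed.

(** A shortcut keeps the ends of its block, so the choices contribute independently. *)
Lemma walk_tour S prs l a :
  walk w l (rcons (tour S prs) a) =
    \sum_(q <- prs) gain S q.1 + walk w l (rcons (tour set0 prs) a).
Proof.
elim: prs l => [|[o r] prs IH] l; first by rewrite big_nil add0r.
rewrite big_cons !rcons_tour !walk_cat !last_rcons IH walk_block.
by rewrite -!addrA; congr (_ + _); rewrite addrCA.
Qed.

(** The difference is the sum of the detours of [(l, g.1.1, g.2)] and [(l, g.2, r)]. *)
Lemma walk_block0 W A R o l r : rigid W A R -> aligned W A R ->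
  (forall g, o = Some g -> g \in A) -> l \in R -> r \in R -> l != r ->
  walk w l (rcons (block set0 o) r) - w l r \in W.
Proof.
move=> rW aW; case: o => [g|] oA lR rR lr /=; last by rewrite addr0 subrr mem0v.
have gA := oA g erefl; rewrite in_set0 /=.
have [[p3 _] _ dAR _ _] := rW.
have gR x : x \in supp g -> x \notin R.
  move=> xg; have := disjointWl (supps_sup gA) dAR.
  by rewrite disjoints_subset => /subsetP/(_ x xg); rewrite inE.
have xg : g.1.1 \in supp g by rewrite !inE eqxx.
have zg : g.2 \in supp g by rewrite !inE eqxx !orbT.
have xz : g.1.1 != g.2.
  have := p3 g gA; rewrite /supp; case: eqP => // ->.
  by rewrite setUAC setUid cards2; case: (_ != _).
have ne x y : x \in supp g -> y \in R -> x != y.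
  by move=> /gR xR yR; apply: contraNneq xR => ->.
have D t : #|supp t| = 3 -> supp t \subset supp g :|: R -> detour t \in W by apply: aW.
have D1 : detour (l, g.1.1, g.2) \in W.
  apply: D; rewrite /supp /=.
    by rewrite -setUA cardsU1 cards2 xz !inE negb_or ![l == _]eq_sym !ne.
  by rewrite !subUset !sub1set !inE lR !eqxx !orbT.
have D2 : detour (l, g.2, r) \in W.
  apply: D; rewrite /supp /=.
    by rewrite -setUA cardsU1 cards2 ne // !inE negb_or lr eq_sym ne.
  by rewrite !subUset !sub1set !inE lR rR !eqxx !orbT.
have := memvD D1 D2; rewrite /detour /= addr0.
by rewrite !addrA subrK.
Qed.

(** Modulo [W] each block is replaced by an arc inside [R], and the resulting path contracts through
    triples of [R]. *)
Lemma walk_tour0 W A R prs l a : rigid W A R -> aligned W A R ->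
  (forall g r, (Some g, r) \in prs -> g \in A) ->
  {subset a :: l :: unzip2 prs <= R} -> uniq (a :: l :: unzip2 prs) ->
  walk w l (rcons (tour set0 prs) a) - w l a \in W.
Proof.
move=> rW aW; elim: prs l => [|[o r] prs IH] l prsA sR Ur.
  by rewrite /= addr0 subrr mem0v.
have [aR lR rR] : [/\ a \in R, l \in R & r \in R].
  by split; apply: sR; rewrite !inE eqxx ?orbT.
have [al ar lr] : [/\ a != l, a != r & l != r].
  by move: Ur; rewrite /= !inE !negb_or => /and3P[/and3P[-> -> _] /andP[-> _] _].
rewrite rcons_tour walk_cat last_rcons.
have B : walk w l (rcons (block set0 o) r) - w l r \in W.
  by apply: walk_block0 rW aW _ lR rR lr => g og; apply: (prsA g r); rewrite og mem_head.
have {}IH : walk w r (rcons (tour set0 prs) a) - w r a \in W.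
  apply: IH => [g s gs | x xs |].
  - by apply: (prsA g s); rewrite inE gs orbT.
  - by apply: sR; move: xs; rewrite !inE => /orP[->|->]; rewrite ?orbT.
  - by move: Ur; rewrite /= !inE !negb_or => /and3P[/and3P[_ -> ->] _ ->].
have D : detour (l, r, a) \in W.
  apply: (rigid_triple rW); rewrite /supp /=.
    by rewrite -setUA cardsU1 cards2 !inE negb_or lr [l == a]eq_sym al [r == a]eq_sym ar.
  by rewrite !subUset !sub1set lR rR.
have := memvD (memvD B IH) D; rewrite /detour /=.
by rewrite [_ - w l r + _]addrACA -opprD addrA subrK.
Qed.

Lemma uniq_tour A R S prs : packing A -> [disjoint supps A & R] ->
  (forall g r, (Some g, r) \in prs -> g \in A) ->
  uniq (pmap fst prs) -> {subset unzip2 prs <= R} -> uniq (unzip2 prs) ->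
  uniq (tour S prs) /\
  (forall x, x \in tour S prs ->
    x \in unzip2 prs \/ exists2 g, g \in pmap fst prs & x \in supp g).
Proof.
move=> pA dAR.
have Ub o : (forall g, o = Some g -> g \in A) -> uniq (block S o).
  case: o => [g|] // /(_ g erefl)/pA.1; rewrite /supp /=.
  have [g12|g12] := eqVneq g.1.1 g.1.2.
    by rewrite g12 setUid cards2; case: (_ != _).
  have [g13|g13] := eqVneq g.1.1 g.2.
    by rewrite g13 setUAC setUid cards2; case: (_ != _).
  have [g23|g23] := eqVneq g.1.2 g.2.
    by rewrite g23 -setUA setUid cards2; case: (_ != _).
  by case: ifP => _ _; rewrite /= !inE ?negb_or ?g12 ?g13 ?g23.
have bs o x : x \in block S o -> exists2 g, o = Some g & x \in supp g.
  case: o => [g|] //= xb; exists g => //; move: xb; rewrite /supp.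
  by case: ifP => _; rewrite !inE; [case/or3P=> -> | case/orP=> ->]; rewrite ?orbT.
elim: prs => [|[o r] prs IH] prsA Ug sR Ur; first by split.
have [||||U1 M1] := IH.
- by move=> g s gs; apply: (prsA g s); rewrite inE gs orbT.
- by move: Ug; case: (o) => //= g /andP[].
- by move=> x xs; apply: sR; rewrite /= inE xs orbT.
- by case/andP: Ur.
have oA g : o = Some g -> g \in A.
  by move=> og; apply: (prsA g r); rewrite og mem_head.
have rR : r \in R by apply: sR; rewrite mem_head.
have AR g x : g \in A -> x \in supp g -> x \notin R.
  move=> gA xg; have := disjointWl (supps_sup gA) dAR.
  by rewrite disjoints_subset => /subsetP/(_ x xg); rewrite inE.
have pmA g : g \in pmap fst prs -> g \in A.
  rewrite mem_pmap => /mapP[[o' s] os] /= og; apply: (prsA g s).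
  by rewrite inE og os orbT.
rewrite /tour /= -/(tour S prs); split; last first.
  move=> x; rewrite mem_cat mem_rcons inE => /orP[/orP[/eqP->|xb]|/M1[xs|[g gs xg]]].
  - by left; rewrite mem_head.
  - have [g -> xg] := bs _ _ xb; by right; exists g; rewrite ?mem_head.
  - by left; rewrite inE xs orbT.
  - by right; exists g => //; case: (o) => [h|] //=; rewrite inE gs orbT.
rewrite cat_uniq U1 andbT rcons_uniq Ub // andbT; apply/andP; split.
  by apply/negP=> /bs[g /oA gA /(AR _ _ gA)]; rewrite rR.
apply/hasPn=> x /M1 xt; rewrite mem_rcons inE negb_or.
have [xs | [g gs xg]] := xt.
  have xR : x \in R by apply: sR; rewrite inE xs orbT.
  apply/andP; split.
    by apply/eqP=> xr; move: Ur; rewrite /= -xr xs.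
  by apply/negP=> /bs[g /oA gA /(AR _ _ gA)]; rewrite xR.
have gA := pmA _ gs; have xR := AR _ _ gA xg.
apply/andP; split; first by apply: contraNneq xR => ->.
apply/negP=> /bs[h oh xh]; have hA := oA _ oh.
have gh : g != h by apply: contraTneq Ug; rewrite oh /= => <-; rewrite gs.
have := pA.2 _ _ gA hA gh; rewrite -setI_eq0 => /eqP/setP/(_ x).
by rewrite in_setI xg xh in_set0.
Qed.

(** With all shortcuts taken, the tour weighs modulo [W] as much as a 2-cycle in [R], that is 0; the
    detours over [S] then cancel the remaining element of [W]. *)
Lemma rigid_zero_sum W A R : (0 < \dim {:V})%N -> rigid W A R -> aligned W A R ->
  (forall u, u \in W -> exists2 S : {set T}, S \subset A & \sum_(t in S) detour t = u) ->
  exists c : seq X, [/\ uniq c, (2 <= size c)%N & \sum_(x <- c) w x (next c x) = 0].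
Proof.
move=> V_gt0 rW aW sums; have [pA [_ _ cA] dAR cR _] := rW.
pose os := if A == set0 then [:: None] else [seq Some g | g <- enum A].
(* One vertex of [R] follows each block and one more, [a], starts the cycle. If [A] is empty, [W] is
   zero and the spare vertices suffice. *)
have szos : (size os < #|R|)%N.
  rewrite /os; case: eqP => [A0|/eqP A0].
    have dW : \dim W = 0%N.
      apply/eqP; move: cA; rewrite A0 cards0 => /esym/eqP.
      by rewrite muln_eq0 -leqn0 leqNgt m_gt0.
    have WV : W != fullv by apply: contraTneq V_gt0 => <-; rewrite dW.
    by move: cR; rewrite dW muln0 WV /=; lia.
  rewrite size_map -cardE; move: A0 cR; rewrite -card_gt0 cA.
  by case: eqP => _ /=; lia.
have [a [rs [rsz sR Ur]]] : exists a rs,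
    [/\ size rs = size os, {subset a :: rs <= R} & uniq (a :: rs)].
  move: szos; rewrite cardE; case E: (enum R) => [|a s] //=; rewrite ltnS => les.
  exists a, (take (size os) s); split.
  - by rewrite size_takel.
  - move=> x xs; rewrite -mem_enum E; move: xs.
    by rewrite !inE => /orP[->//|/mem_take ->]; rewrite orbT.
  - have /andP[an Us] : uniq (a :: s) by rewrite -E enum_uniq.
    rewrite /= take_uniq // andbT.
    by apply: contra an; apply: mem_take.
pose prs := zip os rs.
have z1 : unzip1 prs = os by apply: unzip1_zip; rewrite rsz.
have z2 : unzip2 prs = rs by apply: unzip2_zip; rewrite rsz.
have pm : pmap fst prs = enum A.
  have -> : pmap fst prs = pmap id (unzip1 prs).
    by elim: (prs) => //= q qs ->.
  rewrite z1 /os; case: eqP => [->|_]; first by rewrite enum_set0.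
  by elim: (enum A) => //= g gs ->.
have prs_gt0 : (0 < size prs)%N.
  rewrite size_zip rsz minnn /os; case: eqP => // /eqP.
  by rewrite size_map -cardE card_gt0.
have prsA g r : (Some g, r) \in prs -> g \in A.
  move=> gr; have : g \in pmap fst prs by rewrite mem_pmap; apply/mapP; exists (Some g, r).
  by rewrite pm mem_enum.
have cyc S : uniq (a :: tour S prs).
  have [|||Ut tm] := @uniq_tour A R S prs pA dAR prsA.
  - by rewrite pm enum_uniq.
  - by rewrite z2 => x xs; apply: sR; rewrite inE xs orbT.
  - by rewrite z2; case/andP: Ur.
  rewrite /= Ut andbT; apply/negP=> /tm[|[g]].
    by rewrite z2; case/andP: Ur => /negPf ->.
  rewrite pm mem_enum => gA ag; have := disjointWl (supps_sup gA) dAR.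
  rewrite disjoints_subset => /subsetP/(_ a ag); by rewrite inE sR ?mem_head.
(* The first block is split off because [walk_tour0] needs its endpoints distinct. *)
have base : walk w a (rcons (tour set0 prs) a) \in W.
  move: prs_gt0 prsA z2; case: (prs) => [//|[o r] qs] _ qsA z2.
  have rsE : rs = r :: unzip2 qs by rewrite -z2.
  have [aR rR] : a \in R /\ r \in R by split; apply: sR; rewrite rsE !inE eqxx ?orbT.
  have ar : a != r by move: Ur; rewrite rsE /= inE negb_or => /andP[/andP[]].
  rewrite rcons_tour walk_cat last_rcons.
  have B : walk w a (rcons (block set0 o) r) - w a r \in W.
    by apply: walk_block0 rW aW _ aR rR ar => g og; apply: (qsA g r); rewrite og mem_head.
  have C : walk w r (rcons (tour set0 qs) a) - w r a \in W.
    apply: (walk_tour0 rW aW); rewrite -?rsE //.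
    by move=> g s gs; apply: (qsA g s); rewrite inE gs orbT.
  have := memvD (memvD B C) (rigid_return rW aR rR ar).
  by rewrite [_ - w a r + _]addrACA -opprD subrK.
have [|S SA SE] := sums (- walk w a (rcons (tour set0 prs) a)); first by rewrite memvN.
exists (a :: tour S prs); split; first exact: cyc.
  by case: (prs) prs_gt0 => // q qs _; rewrite /tour /= size_cat size_rcons.
rewrite sum_next // walk_tour.
suff -> : \sum_(q <- prs) gain S q.1 = \sum_(t in S) detour t by rewrite SE addNr.
rewrite -(big_map fst xpredT (gain S)) -/(unzip1 prs) z1 /os.
case: eqP => [A0|_].
  move: SA; rewrite A0 subset0 => /eqP->.
  by rewrite big_seq1 big_set0.
rewrite big_map big_enum /= -big_mkcondr; apply: eq_bigl => g.
by rewrite andb_idl // => /(subsetP SA).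
Qed.
End Gadgets.

(** * Finiteness of f(p,d) *)

Lemma mask_flatten (I S : Type) (s : seq I) (ms : I -> bitseq) (B : I -> seq S) :
  (forall i, size (ms i) = size (B i)) ->
  mask (flatten [seq ms i | i <- s]) (flatten [seq B i | i <- s])
    = flatten [seq mask (ms i) (B i) | i <- s].
Proof. by move=> sz; elim: s => //= i s IHs; rewrite mask_cat ?IHs. Qed.

Lemma pigeonhole (I Y : finType) (f : I -> Y) k :
  (k * #|Y| < #|I|)%N -> exists y, (k < #|[set i | f i == y]|)%N.
Proof.
move=> lt; apply/existsP; apply: contraTT lt => /existsPn no.
rewrite -leqNgt -sum1_card (partition_big f xpredT) //= mulnC -sum_nat_const.
apply: leq_sum => y _; have := no y; rewrite -leqNgt; apply: leq_trans.
by rewrite sum1_card; apply/eq_leq/eq_card => i; rewrite inE.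
Qed.

(** Among so many bases one ordered basis [y] occurs more than [p] times, and every vector has
    coordinates below [p] in it. *)
Lemma f_prop_exists (p d : nat) : prime p -> exists2 m, (0 < m)%N & f_prop p d m.
Proof.
move=> p_pr; pose Y := (d.-tuple 'rV['F_p]_d)%type.
exists (p * #|{: Y}|).+1 => // B basB x.
have szB i : size (B i) = d.
  by have /andP[/eqP eB /eqP <-] := basB i; rewrite eB dimvf /dim /= mul1n.
pose b i : Y := Tuple (introT eqP (szB i)).
have [|y /ltnW py] := @pigeonhole _ _ b p; first by rewrite card_ord.
set I := [set i | b i == y] in py.
have [i0 i0I] : exists i, i \in I.
  by apply/set0Pn; rewrite -card_gt0; apply: leq_trans py; rewrite prime_gt0.
have yE i : i \in I -> B i = y by rewrite inE => /eqP <-.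
have basy : basis_of fullv y by rewrite -(yE i0).
pose c (j : 'I_d) : nat := coord y j x.
have cp j : (c j < p)%N by have := ltn_ord (coord y j x); rewrite [X in (_ < X)%N]Fp_cast.
(* The [j]-th vector of [y] is taken from the first [c j] copies. *)
pose P i j := i \in take (c j) (enum I).
exists (flatten [seq [seq P i j | j <- enum 'I_d] | i <- enum 'I_(p * #|{: Y}|).+1]).
rewrite mask_flatten; last by move=> i; rewrite size_map size_enum_ord szB.
rewrite big_flatten /= big_map big_enum /=.
transitivity (\sum_i \sum_(j | P i j) y`_j); last first.
  apply: eq_bigr => i _.
  have -> : B i = [seq (B i)`_j | j : 'I_d <- enum 'I_d].
    by rewrite -[LHS](mkseq_nth 0) szB /mkseq -val_enum_ord -map_comp.
  rewrite -map_mask -filter_mask big_map big_filter big_enum_cond /=.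
  apply: eq_bigr => j /mem_take; rewrite mem_enum => /yE Bi.
  by rewrite Bi.
rewrite (exchange_big_dep xpredT) //= {1}(coord_basis basy (memvf x)).
apply: eq_bigr => j _; rewrite sumr_const -[coord y j x]natr_Zp scaler_nat; congr (_ *+ _).
rewrite (@eq_card _ _ (mem (take (c j) (enum I)))) //.
rewrite (card_uniqP _) ?take_uniq ?enum_uniq // size_takel //.
by rewrite -cardE; apply: leq_trans py; apply: ltnW.
Qed.

(** * Conclusion *)

Lemma least_pos_exists (P : nat -> Prop) k : (0 < k)%N -> P k ->
  exists2 n, least_pos P n & (n <= k)%N.
Proof.
move=> k0 Pk.
have [n [n0 Pn] nmin] := @ex_min_classic (fun n => (0 < n)%N /\ P n) k (conj k0 Pk).
by exists n; [split=> // j j0 Pj; apply: nmin | apply: nmin].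
Qed.

(* n(Z_p^d) = nG and f(p,d) = fm both exist, and nG <= 5 d f(p,d). *)
Theorem theorem1 (p d : nat) (hp : prime p) (hd : (0 < d)%N) :
  exists nG fm : nat,
    [/\ least_pos (zero_sum_forced 'rV['F_p]_d) nG,
        least_pos (f_prop p d) fm
      & (nG <= 5 * d * fm)%N].
Proof.
have [k k0 fk] := f_prop_exists d hp.
have [m fm _] := least_pos_exists k0 fk; have [m0 fP _] := fm.
have dimV : \dim {:'rV['F_p]_d} = d by rewrite dimvf /dim /= mul1n.
have forced : zero_sum_forced 'rV['F_p]_d (5 * d * m).
  move=> w; have [|W [A [R [rW aW]]]] := @ex_aligned _ _ _ w m m0.
    by rewrite dimV card_ord.
  have [_ [sA AW cA] _ _ _] := rW.
  apply: (rigid_zero_sum m0 _ rW aW); first by rewrite dimV.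
  exact: sparse_sums m0 fP sA AW cA.
have [|n nG le] := least_pos_exists _ forced; first by rewrite !muln_gt0 hd m0.
by exists n, m.
Qed.
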